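(* Let $\mathcal{S} = \{(p',q') \in [0,1]^{2} : 0 < p'+q' \leqslant 1\}$. For each $(p,q)\in\mathcal{S}$, the envelope PCA $\widehat{F}_{p,q}$ admits no stationary distribution that assigns positive probability to the symbol $?$; that is, for every stationary distribution $\mu$ of $\widehat{F}_{p,q}$, if $\eta$ is a random configuration with law $\mu$, then the probability of the event $\eta(x)=\,?$ is $0$ for every $x\in\mathbb{Z}$.
   Context: The envelope PCA (probabilistic cellular automaton) $\widehat{F}_{p,q}$ has alphabet $\hat{\mathcal{A}}=\{0,?,1\}$ (three symbols), neighbourhood $\{0,1,2\}$ and stochastic matrix $\widehat{\varphi}_{p,q}:\hat{\mathcal{A}}^3\times\hat{\mathcal{A}}\to[0,1]$ such that: - $\widehat{\varphi}_{p,q}(0,0,0,\cdot)$ gives mass $p$ to $0$ and $1-p$ to $1$; - for $(a_0,a_1,a_2)\in\hat{\mathcal{A}}^3\setminus\{0,?\}^3$, $\widehat{\varphi}_{p,q}(a_0,a_1,a_2,\cdot)$ gives mass $1-q$ to $0$ and $q$ to $1$; - for $(a_0,a_1,a_2)\in\{0,?\}^3\setminus\{(0,0,0)\}$, $\widehat{\varphi}_{p,q}(a_0,a_1,a_2,\cdot)$ gives mass $p$ to $0$, $q$ to $1$ and $r=1-p-q$ to $?$. Given a configuration $\eta\in\hat{\mathcal{A}}^{\mathbb{Z}}$, the random configuration $\widehat{F}_{p,q}\eta\in\hat{\mathcal{A}}^{\mathbb{Z}}$ has independent coordinates, with $\mathbf{P}[\widehat{F}_{p,q}\eta(n)=b]=\widehat{\varphi}_{p,q}(\eta(n),\eta(n+1),\eta(n+2),b)$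 for $n\in\mathbb{Z}$, $b\in\hat{\mathcal{A}}$. If $\eta$ is random with law $\mu$ (a probability measure on $\hat{\mathcal{A}}^{\mathbb{Z}}$ with the $\sigma$-field generated by cylinder sets), $\widehat{F}_{p,q}\mu$ denotes the law of $\widehat{F}_{p,q}\eta$. A probability measure $\mu$ is stationary for $\widehat{F}_{p,q}$ if $\widehat{F}_{p,q}\mu=\mu$. *)

(* Defs.v *)
From HB Require Import structures.
From mathcomp Require Import all_boot all_order all_algebra finmap.
From mathcomp Require Import all_classical all_reals all_analysis.
Set Implicit Arguments.
Unset Strict Implicit.
Unset Printing Implicit Defensive.
Import Order.TTheory GRing.Theory Num.Theory.
Local Open Scope classical_set_scope.
Local Open Scope ring_scope.

(* The alphabet {0, ?, 1}. *)
Inductive symbol := Zero | Unknown | One.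

Definition symbol_code (a : symbol) : option bool :=
  match a with Zero => Some false | Unknown => None | One => Some true end.
Definition symbol_decode (c : option bool) : symbol :=
  match c with Some false => Zero | None => Unknown | Some true => One end.
Lemma symbol_codeK : cancel symbol_code symbol_decode.
Proof. by case. Qed.
HB.instance Definition _ := Finite.copy symbol (can_type symbol_codeK).
HB.instance Definition _ := isPointed.Build symbol Zero.

Definition cylinder : set (set (int -> symbol)) :=
  [set C | exists (J : {fset int}) (b : int -> symbol),
      C = [set eta | forall n, n \in J -> eta n = b n]].

Definition config : measurableType _ := g_sigma_algebraType cylinder.

(* Mutual independence of the coordinates of a configuration with law nu.
   Every B n is an event for the n-th coordinate, the alphabet being finite. *)
Definition independent_coordinates (R : realType)
    (nu : {measure set config -> \bar R}) : Prop :=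
  forall (J : {fset int}) (B : int -> set symbol),
    nu [set xi : config | forall n, n \in J -> B n (xi n)] =
    (\prod_(n <- J) nu [set xi : config | B n (xi n)])%E.

(* F is the PCA with neighbourhood {0, 1, 2} and stochastic matrix phi, F eta
   being the law of the random image of eta. These conditions fix F eta on
   cylinders, hence determine F; such an F exists when phi is stochastic, each
   F eta being a product measure. *)
Definition is_PCA (R : realType) (phi : symbol -> symbol -> symbol -> symbol -> R)
    (F : R.-pker config ~> config) : Prop :=
  forall eta : config,
    (forall (n : int) (b : symbol),
      F eta [set xi : config | xi n = b] =
      (phi (eta n) (eta (n + 1)) (eta (n + 2)) b)%:E) /\
    independent_coordinates (F eta).

(* The law of F eta when eta is random with law mu. *)
Definition PCA_law (R : realType) (F : R.-pker config ~> config)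
    (mu : probability config R) (A : set config) : \bar R :=
  (\int[mu]_eta F eta A)%E.

Definition stationary (R : realType) (F : R.-pker config ~> config)
    (mu : probability config R) : Prop :=
  forall A : set config, measurable A -> PCA_law F mu A = mu A.

Definition envelope_matrix (R : realType) (p q : R)
    (a0 a1 a2 b : symbol) : R :=
  if [&& a0 == Zero, a1 == Zero & a2 == Zero] then
    match b with Zero => p | Unknown => 0 | One => 1 - p end
  else if [|| a0 == One, a1 == One | a2 == One] then
    match b with Zero => 1 - q | Unknown => 0 | One => q end
  else
    match b with Zero => p | Unknown => 1 - p - q | One => q end.

Definition is_envelope_PCA (R : realType) (p q : R)
    (F : R.-pker config ~> config) : Prop :=
  is_PCA (envelope_matrix p q) F.

Definition parameters (R : realType) : set (R * R) :=
  [set s | 0 <= s.1 <= 1 /\ 0 <= s.2 <= 1 /\ 0 < s.1 + s.2 <= 1].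

(* Main.v *)
Require Import Defs.
From HB Require Import structures.
From mathcomp Require Import all_boot all_order all_algebra finmap.
From mathcomp Require Import all_classical all_reals all_analysis.
From mathcomp Require Import ring lra.
Import measurable_realfun.
Import Order.TTheory GRing.Theory Num.Theory.
Local Open Scope classical_set_scope.
Local Open Scope ring_scope.

(* The envelope PCA is monotone when ? is put above 0 and 1, so a stationary
   measure gives the event [eta x = ?] at most the probability of a ? at time
   [n] when the initial configuration consists of ?'s only, for every [n]. The
   latter process is shift-invariant. Writing A_j for the probability of a word
   of length j without 1 and with at least one ?, the weight
     3 A_3 - 2 A_4 + (1 + p + p^2 (1 - p)) (P(?000) + P(000?))
   is bounded and decreases at each step by at least a positive multiple of A_3,
   while (1 - p - q) A_3 is the probability of a ? at the next step. Hence these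
   probabilities are summable over time, so they become arbitrarily small. *)

Set Implicit Arguments.
Unset Strict Implicit.
Unset Printing Implicit Defensive.

(** * Words and shift-invariant laws *)

Definition symbols : seq symbol := [:: Zero; Unknown; One].

Lemma mem_symbols (a : symbol) : a \in symbols.
Proof. by case: a. Qed.

Fixpoint words (L : nat) : seq (seq symbol) :=
  if L is L'.+1 then [seq a :: w | a <- symbols, w <- words L'] else [:: [::]].

Lemma mem_words (L : nat) (w : seq symbol) : (w \in words L) = (size w == L).
Proof.
elim: L w => [|L IH] [|a w]; try by [].
  by apply/negbTE/allpairsPdep => -[b [u [_ _]]].
apply/allpairsPdep/idP => [[b [u [_ uL [_ ->]]]]|wL].
  by rewrite /= eqSS -IH.
by exists a, w; rewrite mem_symbols IH.
Qed.

Lemma words_uniq (L : nat) : uniq (words L).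
Proof.
elim: L => [//|L IH]; apply: allpairs_uniq => //.
by move=> [a u] [b v] _ _ [-> ->].
Qed.

Section Step.
Context {R : realType} (phi : symbol -> symbol -> symbol -> symbol -> R).

(** The image letters are independent given [v]. Meant for [v] two letters longer than [w], so that
    the default [Unknown] is never read. *)
Fixpoint word_prob (v w : seq symbol) : R :=
  if w is b :: w' then
    phi (nth Unknown v 0) (nth Unknown v 1) (nth Unknown v 2) b *
      word_prob (behead v) w'
  else 1.

(* The dual action of the PCA on functions of words: the expected value of [f]
   on the image word of length [L] of a word [v] of length [L.+2]. *)
Definition step (L : nat) (f : seq symbol -> R) (v : seq symbol) : R :=
  \sum_(w <- words L) word_prob v w * f w.

Lemma step0 f v : step 0 f v = f [::].
Proof. by rewrite /step big_seq1 mul1r. Qed.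

Lemma stepS L f v : step L.+1 f v =
  \sum_(a <- symbols) phi (nth Unknown v 0) (nth Unknown v 1) (nth Unknown v 2) a *
     step L (fun w => f (a :: w)) (behead v).
Proof.
rewrite /step big_allpairs_dep; apply: eq_bigr => a _.
by rewrite big_distrr; apply: eq_bigr => w _; rewrite /= mulrA.
Qed.

Lemma step_lin L a f g v :
  step L (fun w => a * f w + g w) v = a * step L f v + step L g v.
Proof.
rewrite /step mulr_sumr -big_split; apply: eq_bigr => w _.
by rewrite /=; ring.
Qed.

Hypothesis phi_ge0 : forall a b c d, 0 <= phi a b c d.
Hypothesis phi_sum1 : forall a b c, \sum_(d <- symbols) phi a b c d = 1.

Lemma word_prob_ge0 v w : 0 <= word_prob v w.
Proof. by elim: w v => //= b w IH v; rewrite mulr_ge0. Qed.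

Lemma step_ge0 L f v : (forall w, size w = L -> 0 <= f w) -> 0 <= step L f v.
Proof.
move=> f0; rewrite /step big_seq sumr_ge0 // => w.
by rewrite mem_words => /eqP/f0 fw; rewrite mulr_ge0 // word_prob_ge0.
Qed.

Lemma step_behead L f v :
  step L.+1 (fun w => f (behead w)) v = step L f (behead v).
Proof. by rewrite stepS /= -mulr_suml phi_sum1 mul1r. Qed.

(** The last image letter sums out to 1; it is the last one met by the recursion, hence the
    induction on [L]. *)
Lemma step_take L f v :
  step L.+1 (fun w => f (take L w)) v = step L f (take L.+2 v).
Proof.
elim: L f v => [|L IH] f v.
  rewrite stepS step0 -[RHS]mul1r.
  rewrite -(phi_sum1 (nth Unknown v 0) (nth Unknown v 1) (nth Unknown v 2)).
  by rewrite mulr_suml; apply: eq_bigr => a _; rewrite step0.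
rewrite stepS [RHS]stepS; apply: eq_bigr => a _.
rewrite !nth_take //; congr (_ * _).
rewrite (IH (fun w => f (a :: w))); congr step.
by case: v.
Qed.

End Step.

(* A shift-invariant law, given by the expectations [E L f] of the functions [f]
   of its words of length [L]. *)
Record invariant_law (R : realType) (E : nat -> (seq symbol -> R) -> R) : Prop :=
  InvariantLaw {
  law_lin : forall L a f g,
    E L (fun w => a * f w + g w) = a * E L f + E L g;
  law_ge0 : forall L f, (forall w, size w = L -> 0 <= f w) -> 0 <= E L f;
  law_one : E 0 (fun _ => 1) = 1;
  law_behead : forall L f, E L.+1 (fun w => f (behead w)) = E L f;
  law_take : forall L f, E L.+1 (fun w => f (take L w)) = E L f }.

Section Law.
Context {R : realType} {E : nat -> (seq symbol -> R) -> R}.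
Hypothesis hE : invariant_law E.

Lemma law0 L : E L (fun _ => 0) = 0.
Proof.
have := law_lin hE L 1 (fun _ => 0) (fun _ => 0).
under [X in E L X]funext do rewrite mulr0 addr0.
by lra.
Qed.

Lemma lawD L f g : E L (fun w => f w + g w) = E L f + E L g.
Proof.
by rewrite -[E L f]mul1r -(law_lin hE); congr E; apply/funext => w; rewrite mul1r.
Qed.

Lemma lawZ L a f : E L (fun w => a * f w) = a * E L f.
Proof.
rewrite -[RHS]addr0 -{1}(law0 L) -(law_lin hE); congr E.
by apply/funext => w; rewrite addr0.
Qed.

Lemma lawN L f : E L (fun w => - f w) = - E L f.
Proof.
rewrite -[RHS]mulN1r -lawZ; congr E.
by apply/funext => w; rewrite mulN1r.
Qed.

Lemma law_le L f g : (forall w, size w = L -> f w <= g w) -> E L f <= E L g.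
Proof.
move=> fg; rewrite -subr_ge0 -lawN -lawD.
by apply: (law_ge0 hE) => w /fg; rewrite subr_ge0.
Qed.

Lemma law_eq L f g : (forall w, size w = L -> f w = g w) -> E L f = E L g.
Proof.
move=> fg; apply: le_anti; apply/andP; split; apply: law_le => w sw.
  by rewrite fg.
by rewrite fg.
Qed.

Lemma law_cst L a : E L (fun _ => a) = a.
Proof.
elim: L => [|L IH]; last exact: etrans (law_behead hE L (fun _ => a)) IH.
by have := lawZ 0 a (fun _ => 1); rewrite (law_one hE) mulr1.
Qed.

Lemma law_drop i L f : E (i + L) (fun w => f (drop i w)) = E L f.
Proof.
elim: i f => [|i IH] f; first by under [X in E _ X]funext do rewrite drop0.
rewrite -[RHS]IH -[RHS](law_behead hE) addSn; congr E; apply/funext => w.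
by case: w.
Qed.

Lemma law_takeD i L f : E (L + i) (fun w => f (take L w)) = E L f.
Proof.
elim: i => [|i IH].
  by rewrite addn0; apply: law_eq => w sw; rewrite take_oversize ?sw.
rewrite addnS -[RHS]IH -[RHS](law_take hE); congr E; apply/funext => w.
by rewrite take_takel ?leq_addr.
Qed.

(** Consistency of the image law when an end letter is dropped comes from [step_behead] and
    [step_take]. *)
Lemma step_invariant_law (phi : symbol -> symbol -> symbol -> symbol -> R) :
  (forall a b c d, 0 <= phi a b c d) ->
  (forall a b c, \sum_(d <- symbols) phi a b c d = 1) ->
  invariant_law (fun L f => E L.+2 (step phi L f)).
Proof.
move=> phi0 phi1; split.
- move=> L a f g; rewrite -(law_lin hE); congr E.
  by apply/funext => v; rewrite step_lin.
- by move=> L f f0; apply: (law_ge0 hE) => v _; apply: step_ge0.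
- by rewrite -[RHS](law_cst 2); congr E; apply/funext => v; rewrite step0.
- move=> L f; rewrite -[RHS](law_behead hE); congr E.
  by apply/funext => v; rewrite step_behead.
- move=> L f; rewrite -[RHS](law_take hE); congr E.
  by apply/funext => v; rewrite step_take.
Qed.

End Law.

(** * Pattern probabilities *)

(** Only a prefix of [w] is tested, so patterns of different lengths can be read in one window. *)
Fixpoint matches (ps : seq (pred symbol)) (w : seq symbol) : bool :=
  match ps, w with
  | P :: ps', a :: w' => P a && matches ps' w'
  | [::], _ => true
  | _, [::] => false
  end.

Lemma matches_take ps w : matches ps (take (size ps) w) = matches ps w.
Proof. by elim: ps w => [|P ps IH] [|a w] //=; rewrite IH. Qed.

Definition not_one : pred symbol := fun a => a != One.
Definition is_zero : pred symbol := fun a => a == Zero.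
Definition is_unknown : pred symbol := fun a => a == Unknown.

Section Patterns.
Context {R : realType} {E : nat -> (seq symbol -> R) -> R}.
Hypothesis hE : invariant_law E.

Definition pattern_prob (ps : seq (pred symbol)) : R :=
  E (size ps) (fun w => (matches ps w)%:R).

Lemma pattern_prob_at i L ps : (i + size ps <= L)%N ->
  E L (fun w => (matches ps (drop i w))%:R) = pattern_prob ps.
Proof.
move=> /subnKC <-; rewrite /pattern_prob -[RHS](law_drop hE i).
rewrite -[RHS](law_takeD hE (L - (i + size ps))); congr E; apply/funext => w.
by rewrite [X in take X]addnC -take_drop matches_take.
Qed.

(** Turns an identity checked word by word into one between pattern probabilities. The entries of
    [l] are coefficient, position and pattern. *)
Lemma pattern_prob_lin L f (l : seq (R * nat * seq (pred symbol))) :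
  all (fun x => x.1.2 + size x.2 <= L)%N l ->
  (forall v, size v = L ->
    f v = \sum_(x <- l) x.1.1 * (matches x.2 (drop x.1.2 v))%:R) ->
  E L f = \sum_(x <- l) x.1.1 * pattern_prob x.2.
Proof.
move=> + /(law_eq hE) ->; elim: l => [|x l IH] /=.
  move=> _; rewrite big_nil -[RHS](law0 hE L); congr E.
  by apply/funext => v; rewrite big_nil.
move=> /andP[xL /IH {}IH]; rewrite big_cons -IH -(pattern_prob_at xL).
rewrite -(lawZ hE) -(lawD hE); congr E.
by apply/funext => v; rewrite big_cons.
Qed.

(** It suffices to compare numbers of occurrences on each of the finitely many words of length [L].
    Positions matter for this check, but by invariance not for the probabilities. *)
Lemma pattern_prob_le L (l1 l2 : seq (nat * seq (pred symbol))) :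
  all (fun x => x.1 + size x.2 <= L)%N (l1 ++ l2) ->
  all (fun w => sumn [seq (matches x.2 (drop x.1 w) : nat) | x <- l1] <=
      sumn [seq (matches x.2 (drop x.1 w) : nat) | x <- l2])%N (words L) ->
  \sum_(x <- l1) pattern_prob x.2 <= \sum_(x <- l2) pattern_prob x.2.
Proof.
rewrite all_cat => /andP[h1 h2] /allP h12.
have H l : all (fun x => x.1 + size x.2 <= L)%N l ->
    E L (fun w => (sumn [seq (matches x.2 (drop x.1 w) : nat) | x <- l])%:R) =
    \sum_(x <- l) pattern_prob x.2.
  elim: l => [|x l IH] /= => [_|/andP[xL /IH {}IH]].
    by rewrite big_nil (law0 hE).
  rewrite big_cons -IH -(pattern_prob_at xL) -(lawD hE); congr E.
  by apply/funext => v; rewrite natrD.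
by rewrite -H // -H //; apply: (law_le hE) => w sw; rewrite ler_nat h12 // mem_words sw.
Qed.

Lemma pattern_prob0 : pattern_prob [::] = 1.
Proof. exact: law_one. Qed.

End Patterns.
Arguments pattern_prob {R} E ps.

(** * Linear inequalities between pattern probabilities *)

Section PatternInequalities.
Context {R : realType} {E : nat -> (seq symbol -> R) -> R}.
Hypothesis hE : invariant_law E.
Local Notation P := (pattern_prob E).
Local Notation n := not_one.
Local Notation o := is_zero.
Local Notation u := is_unknown.


Ltac pattern_le L l1 l2 :=
  have := @pattern_prob_le _ _ hE L l1 l2 isT ltac:(vm_compute; reflexivity);
  rewrite !big_cons !big_nil /=; lra.

Lemma pattern_prob_ge0 ps : 0 <= P ps.
Proof. exact: (law_ge0 hE). Qed.

Lemma pattern_prob_le1 ps : P ps <= 1.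
Proof.
rewrite -(law_cst hE (size ps) 1); apply: (law_le hE) => w _.
by case: (matches _ _).
Qed.

Lemma zeros_le_not_one3 : P (nseq 3 o) <= P (nseq 3 n).
Proof. by pattern_le 3%N [:: (0%N, nseq 3 o)] [:: (0%N, nseq 3 n)]. Qed.

Lemma not_one_zeros : P (n :: nseq 3 o) = P (u :: nseq 3 o) + P (nseq 4 o).
Proof.
apply/le_anti/andP; split.
  by pattern_le 4%N [:: (0%N, n :: nseq 3 o)] [:: (0%N, u :: nseq 3 o); (0%N, nseq 4 o)].
by pattern_le 4%N [:: (0%N, u :: nseq 3 o); (0%N, nseq 4 o)] [:: (0%N, n :: nseq 3 o)].
Qed.

Lemma zeros_not_one : P (rcons (nseq 3 o) n) = P (rcons (nseq 3 o) u) + P (nseq 4 o).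
Proof.
apply/le_anti/andP; split.
  by pattern_le 4%N [:: (0%N, rcons (nseq 3 o) n)]
       [:: (0%N, rcons (nseq 3 o) u); (0%N, nseq 4 o)].
by pattern_le 4%N [:: (0%N, rcons (nseq 3 o) u); (0%N, nseq 4 o)]
     [:: (0%N, rcons (nseq 3 o) n)].
Qed.

(** In a word of length 4 without 1 and with a ?, both triples contain a ?, except that one of them
    fails in ?000 and in 000?. *)
Lemma run_end_ge0 :
  P (nseq 3 o) *+ 2 + P (nseq 4 n) *+ 2 <=
  P (nseq 3 n) *+ 2 + P (nseq 4 o) *+ 2 +
    P (u :: nseq 3 o) + P (rcons (nseq 3 o) u).
Proof.
by pattern_le 4%N
  [:: (0%N, nseq 3 o); (1%N, nseq 3 o); (0%N, nseq 4 n); (0%N, nseq 4 n)]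
  [:: (0%N, nseq 3 n); (1%N, nseq 3 n); (0%N, nseq 4 o); (0%N, nseq 4 o);
      (0%N, u :: nseq 3 o); (0%N, rcons (nseq 3 o) u)].
Qed.

(** Convexity in [j] of A_j up to end terms: a central run is compared with its extensions to the
    left, to the right and to both sides. If the centre contains a ?, the difference is the
    indicator that both neighbours are 1; if it is 000, that both are ?. The same holds for
    [run_convex4]. *)
Lemma run_convex3 :
  P (nseq 3 o) + P (nseq 4 n) *+ 2 + P (nseq 5 o) +
    P (u :: nseq 4 o) + P (rcons (nseq 4 o) u) <=
  P (nseq 3 n) + P (nseq 4 o) *+ 2 + P (nseq 5 n) +
    P (u :: nseq 3 o) + P (rcons (nseq 3 o) u).
Proof.
by pattern_le 5%N
  [:: (1%N, nseq 3 o); (0%N, nseq 4 n); (1%N, nseq 4 n); (0%N, nseq 5 o);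
      (0%N, u :: nseq 4 o); (0%N, rcons (nseq 4 o) u)]
  [:: (1%N, nseq 3 n); (0%N, nseq 4 o); (1%N, nseq 4 o); (0%N, nseq 5 n);
      (0%N, u :: nseq 3 o); (1%N, rcons (nseq 3 o) u)].
Qed.

Lemma run_convex4 :
  P (nseq 4 o) + P (nseq 5 n) *+ 2 + P (nseq 6 o) +
    P (u :: nseq 5 o) + P (rcons (nseq 5 o) u) <=
  P (nseq 4 n) + P (nseq 5 o) *+ 2 + P (nseq 6 n) +
    P (u :: nseq 4 o) + P (rcons (nseq 4 o) u).
Proof.
by pattern_le 6%N
  [:: (1%N, nseq 4 o); (0%N, nseq 5 n); (1%N, nseq 5 n); (0%N, nseq 6 o);
      (0%N, u :: nseq 5 o); (0%N, rcons (nseq 5 o) u)]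
  [:: (1%N, nseq 4 n); (0%N, nseq 5 o); (1%N, nseq 5 o); (0%N, nseq 6 n);
      (0%N, u :: nseq 4 o); (1%N, rcons (nseq 4 o) u)].
Qed.

(** In a word [nn000], the ? nearest to the final zeros gives ?000 or ?0000; without ? the word is
    00000. The mirrored pattern is alike. *)
Lemma zero_end2 :
  P (nseq 2 n ++ nseq 3 o) + P (nseq 3 o ++ nseq 2 n) <=
  P (nseq 5 o) *+ 2 + P (u :: nseq 3 o) + P (rcons (nseq 3 o) u) +
    P (u :: nseq 4 o) + P (rcons (nseq 4 o) u).
Proof.
by pattern_le 5%N
  [:: (0%N, nseq 2 n ++ nseq 3 o); (0%N, nseq 3 o ++ nseq 2 n)]
  [:: (0%N, nseq 5 o); (0%N, nseq 5 o); (1%N, u :: nseq 3 o);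
      (0%N, rcons (nseq 3 o) u); (0%N, u :: nseq 4 o); (0%N, rcons (nseq 4 o) u)].
Qed.

(** An occurrence of [nnn000] contains one of [nn000]. When the latter is 00000, it extends exactly
    to 000000 or ?00000. *)
Lemma zero_end3 :
  P (nseq 3 n ++ nseq 3 o) + P (nseq 3 o ++ nseq 3 n) + P (nseq 5 o) *+ 2 <=
  P (nseq 6 o) *+ 2 + P (nseq 2 n ++ nseq 3 o) + P (nseq 3 o ++ nseq 2 n) +
    P (u :: nseq 5 o) + P (rcons (nseq 5 o) u).
Proof.
by pattern_le 6%N
  [:: (0%N, nseq 3 n ++ nseq 3 o); (0%N, nseq 3 o ++ nseq 3 n);
      (1%N, nseq 5 o); (0%N, nseq 5 o)]
  [:: (0%N, nseq 6 o); (0%N, nseq 6 o); (1%N, nseq 2 n ++ nseq 3 o);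
      (0%N, nseq 3 o ++ nseq 2 n); (0%N, u :: nseq 5 o); (0%N, rcons (nseq 5 o) u)].
Qed.

Lemma zero_end_le :
  P (u :: nseq 5 o) + P (rcons (nseq 5 o) u) <=
  P (u :: nseq 3 o) + P (rcons (nseq 3 o) u).
Proof.
by pattern_le 6%N
  [:: (0%N, u :: nseq 5 o); (0%N, rcons (nseq 5 o) u)]
  [:: (0%N, u :: nseq 3 o); (2%N, rcons (nseq 3 o) u)].
Qed.

End PatternInequalities.

(** * Pattern probabilities after one step of the envelope PCA *)

Section Images.
Context {R : realType} (p q : R).
Local Notation n := not_one.
Local Notation o := is_zero.
Local Notation u := is_unknown.
Local Notation phi := (envelope_matrix p q).
Local Notation s := (1 - q).
Local Notation r := (1 - p - q).

(** By independence of the image letters, a pattern has as conditional probability a product with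
    one factor per letter. *)
Lemma step_matches L (P : pred symbol) ps v :
  step phi L.+1 (fun w => (matches (P :: ps) w)%:R) v =
  (\sum_(a <- symbols)
     phi (nth Unknown v 0) (nth Unknown v 1) (nth Unknown v 2) a * (P a)%:R) *
    step phi L (fun w => (matches ps w)%:R) (behead v).
Proof.
rewrite stepS mulr_suml; apply: eq_bigr => a _ /=.
case: (P a) => /=; rewrite ?mulr1 // mulr0 mul0r; apply/eqP.
rewrite mulf_eq0; apply/orP; right; apply/eqP.
by rewrite /step big1 // => w _; rewrite mulr0.
Qed.

(** In the mixed case this is [p + r = s]. Here [n] is governed by [o], and in [zero_image]
    conversely, so one computation of runs serves both. *)
Lemma not_one_image a b c :
  \sum_(x <- symbols) phi a b c x * (n x)%:R =
  s - r * (matches (nseq 3 o) [:: a; b; c])%:R.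
Proof.
by rewrite !big_cons big_nil; case: a; case: b; case: c; cbn; ring.
Qed.

Lemma zero_image a b c :
  \sum_(x <- symbols) phi a b c x * (o x)%:R =
  s - r * (matches (nseq 3 n) [:: a; b; c])%:R.
Proof.
by rewrite !big_cons big_nil; case: a; case: b; case: c; cbn; ring.
Qed.

Lemma unknown_image a b c :
  \sum_(x <- symbols) phi a b c x * (u x)%:R =
  r * ((matches (nseq 3 n) [:: a; b; c])%:R - (matches (nseq 3 o) [:: a; b; c])%:R).
Proof.
by rewrite !big_cons big_nil; case: a; case: b; case: c; cbn; ring.
Qed.

Section RunImages.
Context {E : nat -> (seq symbol -> R) -> R} (hE : invariant_law E).
Local Notation P := (pattern_prob E).
Local Notation P' := (pattern_prob (fun L f => E L.+2 (step phi L f))).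

(** Expand the product of the factors of the three image letters: the indicators of overlapping
    triples multiply to that of the run covering them. [run4_image] is alike. *)
Lemma run3_image (Q Q' : pred symbol) :
  (forall a b c, \sum_(x <- symbols) phi a b c x * (Q x)%:R =
    s - r * (matches (nseq 3 Q') [:: a; b; c])%:R) ->
  P' (nseq 3 Q) = s ^+ 3 - 3 * s ^+ 2 * r * P (nseq 3 Q') +
    s * r ^+ 2 * (2 * P (nseq 4 Q') + P (nseq 5 Q')) - r ^+ 3 * P (nseq 5 Q').
Proof.
move=> QE; rewrite {1}/pattern_prob.
rewrite (@pattern_prob_lin _ _ hE 5 _
  [:: (s ^+ 3, 0%N, [::]); (- (s ^+ 2 * r), 0%N, nseq 3 Q');
      (- (s ^+ 2 * r), 1%N, nseq 3 Q'); (- (s ^+ 2 * r), 2%N, nseq 3 Q');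
      (s * r ^+ 2, 0%N, nseq 4 Q'); (s * r ^+ 2, 1%N, nseq 4 Q');
      (s * r ^+ 2 - r ^+ 3, 0%N, nseq 5 Q')]) //.
  by rewrite !big_cons big_nil /= (pattern_prob0 hE); ring.
case=> [|a [|b [|c [|d [|e [|]]]]]] // _.
rewrite !step_matches step0 !QE !big_cons big_nil /=.
by case: (Q' a); case: (Q' b); case: (Q' c); case: (Q' d); case: (Q' e) => /=; ring.
Qed.

Lemma run4_image (Q Q' : pred symbol) :
  (forall a b c, \sum_(x <- symbols) phi a b c x * (Q x)%:R =
    s - r * (matches (nseq 3 Q') [:: a; b; c])%:R) ->
  P' (nseq 4 Q) = s ^+ 4 - 4 * s ^+ 3 * r * P (nseq 3 Q') +
    s ^+ 2 * r ^+ 2 * (3 * P (nseq 4 Q') + 2 * P (nseq 5 Q') + P (nseq 6 Q')) -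
    s * r ^+ 3 * (2 * P (nseq 5 Q') + 2 * P (nseq 6 Q')) +
    r ^+ 4 * P (nseq 6 Q').
Proof.
move=> QE; rewrite {1}/pattern_prob.
rewrite (@pattern_prob_lin _ _ hE 6 _
  [:: (s ^+ 4, 0%N, [::]); (- (s ^+ 3 * r), 0%N, nseq 3 Q');
      (- (s ^+ 3 * r), 1%N, nseq 3 Q'); (- (s ^+ 3 * r), 2%N, nseq 3 Q');
      (- (s ^+ 3 * r), 3%N, nseq 3 Q');
      (s ^+ 2 * r ^+ 2, 0%N, nseq 4 Q'); (s ^+ 2 * r ^+ 2, 1%N, nseq 4 Q');
      (s ^+ 2 * r ^+ 2, 2%N, nseq 4 Q');
      (s ^+ 2 * r ^+ 2 - s * r ^+ 3, 0%N, nseq 5 Q');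
      (s ^+ 2 * r ^+ 2 - s * r ^+ 3, 1%N, nseq 5 Q');
      (s ^+ 2 * r ^+ 2 - 2 * s * r ^+ 3 + r ^+ 4, 0%N, nseq 6 Q')]) //.
  by rewrite !big_cons big_nil /= (pattern_prob0 hE); ring.
case=> [|a [|b [|c [|d [|e [|f [|]]]]]]] // _.
rewrite !step_matches step0 !QE !big_cons big_nil /=.
by case: (Q' a); case: (Q' b); case: (Q' c); case: (Q' d); case: (Q' e);
  case: (Q' f) => /=; ring.
Qed.

(** The factor of the ? is a difference of [nnn] and 000, so the expansion has two families of runs,
    the second beginning with 000. [zeros_unknown_image] is the mirror image. *)
Lemma unknown_zeros_image :
  P' (u :: nseq 3 o) = r * (
    s ^+ 3 * (P (nseq 3 n) - P (nseq 3 o)) -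
    s ^+ 2 * r * (P (nseq 4 n) + P (nseq 5 n) + P (nseq 6 n) -
      P (rcons (nseq 3 o) n) - P (nseq 3 o ++ nseq 2 n) - P (nseq 3 o ++ nseq 3 n)) +
    s * r ^+ 2 * (P (nseq 5 n) + 2 * P (nseq 6 n) -
      P (nseq 3 o ++ nseq 2 n) - 2 * P (nseq 3 o ++ nseq 3 n)) -
    r ^+ 3 * (P (nseq 6 n) - P (nseq 3 o ++ nseq 3 n))).
Proof.
rewrite {1}/pattern_prob (@pattern_prob_lin _ _ hE 6 _
  [:: (r * s ^+ 3, 0%N, nseq 3 n); (- (r * s ^+ 3), 0%N, nseq 3 o);
      (- (r ^+ 2 * s ^+ 2), 0%N, nseq 4 n);
      (r ^+ 2 * s ^+ 2, 0%N, rcons (nseq 3 o) n);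
      (r ^+ 3 * s - r ^+ 2 * s ^+ 2, 0%N, nseq 5 n);
      (r ^+ 2 * s ^+ 2 - r ^+ 3 * s, 0%N, nseq 3 o ++ nseq 2 n);
      (2 * r ^+ 3 * s - r ^+ 2 * s ^+ 2 - r ^+ 4, 0%N, nseq 6 n);
      (r ^+ 2 * s ^+ 2 + r ^+ 4 - 2 * r ^+ 3 * s, 0%N, nseq 3 o ++ nseq 3 n)]) //.
  by rewrite !big_cons big_nil /=; ring.
case=> [|a [|b [|c [|d [|e [|f [|]]]]]]] // _.
rewrite !step_matches step0 !zero_image unknown_image !big_cons big_nil /=.
(* The letters [d], [e] and [f] enter only through [n]. *)
move: (n d) (n e) (n f) => [] [] []; case: a; case: b; case: c; cbn; ring.
Qed.

Lemma zeros_unknown_image :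
  P' (rcons (nseq 3 o) u) = r * (
    s ^+ 3 * (P (nseq 3 n) - P (nseq 3 o)) -
    s ^+ 2 * r * (P (nseq 4 n) + P (nseq 5 n) + P (nseq 6 n) -
      P (n :: nseq 3 o) - P (nseq 2 n ++ nseq 3 o) - P (nseq 3 n ++ nseq 3 o)) +
    s * r ^+ 2 * (P (nseq 5 n) + 2 * P (nseq 6 n) -
      P (nseq 2 n ++ nseq 3 o) - 2 * P (nseq 3 n ++ nseq 3 o)) -
    r ^+ 3 * (P (nseq 6 n) - P (nseq 3 n ++ nseq 3 o))).
Proof.
rewrite {1}/pattern_prob (@pattern_prob_lin _ _ hE 6 _
  [:: (r * s ^+ 3, 3%N, nseq 3 n); (- (r * s ^+ 3), 3%N, nseq 3 o);
      (- (r ^+ 2 * s ^+ 2), 2%N, nseq 4 n);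
      (r ^+ 2 * s ^+ 2, 2%N, n :: nseq 3 o);
      (r ^+ 3 * s - r ^+ 2 * s ^+ 2, 1%N, nseq 5 n);
      (r ^+ 2 * s ^+ 2 - r ^+ 3 * s, 1%N, nseq 2 n ++ nseq 3 o);
      (2 * r ^+ 3 * s - r ^+ 2 * s ^+ 2 - r ^+ 4, 0%N, nseq 6 n);
      (r ^+ 2 * s ^+ 2 + r ^+ 4 - 2 * r ^+ 3 * s, 0%N, nseq 3 n ++ nseq 3 o)]) //.
  by rewrite !big_cons big_nil /=; ring.
case=> [|a [|b [|c [|d [|e [|f [|]]]]]]] // _.
rewrite !step_matches step0 !zero_image unknown_image !big_cons big_nil /=.
move: (n a) (n b) (n c) => [] [] []; case: d; case: e; case: f; cbn; ring.
Qed.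

End RunImages.
End Images.

(** * The weight *)

Section Weight.
Context {R : realType} (p q : R).
Local Notation n := not_one.
Local Notation o := is_zero.
Local Notation u := is_unknown.
Local Notation phi := (envelope_matrix p q).
Local Notation s := (1 - q).
Local Notation r := (1 - p - q).

(** [zero_end_coef_ge0] needs this constant large and [run_end_coef_ge0] needs it small. With this
    value, their slacks at [q = 0] are [p^3] and [p^4] times polynomials that are nonnegative on
    [0,1]. *)
Definition end_weight : R := 1 + p + p ^+ 2 * (1 - p).
Local Notation k := end_weight.

Definition weight (E : nat -> (seq symbol -> R) -> R) : R :=
  3 * (pattern_prob E (nseq 3 n) - pattern_prob E (nseq 3 o)) -
  2 * (pattern_prob E (nseq 4 n) - pattern_prob E (nseq 4 o)) +
  k * (pattern_prob E (u :: nseq 3 o) + pattern_prob E (rcons (nseq 3 o) u)).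

(* The decrease of the weight in one step from the configuration of ?'s only. *)
Definition decay : R :=
  1 - 3 * s ^+ 3 + 2 * s ^+ 4 + p ^+ 3 * (3 - 2 * p - 2 * k * r).

Lemma end_weight_ge : 0 <= p <= 1 -> 1 + p <= k.
Proof.
move=> p01; rewrite /end_weight lerDl.
by apply: mulr_ge0; [exact: sqr_ge0|lra].
Qed.

Lemma end_weight_le2 : 0 <= p <= 1 -> k <= 2.
Proof.
move=> p01; have : 0 <= (1 - p) * (1 - p ^+ 2).
  by apply: mulr_ge0; rewrite subr_ge0 ?expr_le1 //; lra.
by rewrite /end_weight; lra.
Qed.

Lemma decay_gt0 (p0 : 0 <= p) (q0 : 0 <= q) (pq0 : 0 < p + q) (pq1 : p + q <= 1) :
  0 < decay.
Proof.
have p01 : 0 <= p <= 1 by lra.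
have kp := end_weight_ge p01.
(* The first summand is positive when [q > 0], the second when [p > 0]. *)
have -> : decay = q * (1 + s * (1 - s) * (1 + 2 * s)) + p ^+ 3 * (3 - 2 * p - 2 * k * r).
  by rewrite /decay; ring.
have A1 : 1 <= 1 + s * (1 - s) * (1 + 2 * s).
  by rewrite lerDl !mulr_ge0 //; lra.
have B1 : 0 < 3 - 2 * p - 2 * k * r.
  have kr : k * r <= k * (1 - p) by rewrite ler_wpM2l //; lra.
  have kE : k * (1 - p) = 1 - 2 * p ^+ 3 + p ^+ 4 by rewrite /end_weight; ring.
  (* The lower bound [1 - 2 p + 4 p^3 - 2 p^4] equals [2 h1 + 2 h2 + 2 h3 + 7/32], with [h1], [h2],
     [h3] standing for the quantities bounded. *)
  have h1 : 0 <= p * (p - 1 / 2) ^+ 2 by rewrite mulr_ge0 // sqr_ge0.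
  have h2 : 0 <= p ^+ 3 * (1 - p) by rewrite mulr_ge0 ?exprn_ge0 //; lra.
  have h3 : 0 <= (p - 5 / 8) ^+ 2 by exact: sqr_ge0.
  lra.
move: p0; rewrite le_eqVlt => /orP[/eqP p00|pp0].
  by rewrite -p00 expr0n mul0r addr0 mulr_gt0 //; lra.
by rewrite ltr_wpDl ?mulr_ge0 ?mulr_gt0 ?exprn_gt0 //; lra.
Qed.

(** This is the coefficient of P(?000) + P(000?) in [weight_decreases]. Terms with a factor [q] help
    and [r <= 1 - p], so [q = 0] is the worst case. *)
Lemma zero_end_coef_ge0 (p0 : 0 <= p) (q0 : 0 <= q) (pq1 : p + q <= 1) :
  0 <= k - 1 + r ^+ 2 * (3 * s * q - k * p * s - (k + 1) * p ^+ 2).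
Proof.
have p01 : 0 <= p <= 1 by lra.
have kp := end_weight_ge p01.
have r2 : r ^+ 2 <= (1 - p) ^+ 2 by rewrite lerXn2r ?nnegrE; lra.
have h1 : 0 <= r ^+ 2 * (3 * s * q) by rewrite !mulr_ge0 ?sqr_ge0 //; lra.
have h2 : 0 <= r ^+ 2 * (p * (k * q)) by rewrite !mulr_ge0 ?sqr_ge0 //; lra.
have h3 : 0 <= p * (k + (k + 1) * p) by rewrite mulr_ge0 ?addr_ge0 ?mulr_ge0 //; lra.
have h4 := ler_wpM2r h3 r2.
suff : 0 <= k - 1 - (1 - p) ^+ 2 * (p * (k + (k + 1) * p)) by lra.
have -> : k - 1 - (1 - p) ^+ 2 * (p * (k + (k + 1) * p)) =
    p ^+ 3 * (2 * (1 - p ^+ 3) + p * (1 - p) + p ^+ 4).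
  by rewrite /end_weight; ring.
have h5 : p ^+ 3 <= 1 by apply: exprn_ile1; lra.
have h6 : 0 <= p * (1 - p) by rewrite mulr_ge0 //; lra.
have h7 : 0 <= p ^+ 4 by exact: exprn_ge0.
by rewrite mulr_ge0 ?exprn_ge0 //; lra.
Qed.

(** The slack is the coefficient of [run_end_ge0] in [weight_decreases]. The growth of the bracket
    with [q] is absorbed by a factor [1 + q], which the decrease of [r ^+ 2] compensates. *)
Lemma run_end_coef_ge0 (p0 : 0 <= p) (q0 : 0 <= q) (pq1 : p + q <= 1) :
  r ^+ 2 * (3 * s - 3 * s ^+ 2 + k * s ^+ 2 + p * (3 - 4 * s + 2 * k * s) +
    3 * (k - 1) * p ^+ 2) <= 1.
Proof.
have p01 : 0 <= p <= 1 by lra.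
have kp := end_weight_ge p01.
(* [b] is the value of the bracket at [q = 0]. *)
set b := 1 + p + (k - 1) * (1 + 2 * p + 3 * p ^+ 2).
have hb : 1 + 2 * p <= b.
  have h1 : 0 <= (k - 1) * (2 * p + 3 * p ^+ 2).
    by rewrite mulr_ge0 //; [lra|have := sqr_ge0 p; lra].
  rewrite /b; lra.
have le_b : 3 * s - 3 * s ^+ 2 + k * s ^+ 2 + p * (3 - 4 * s + 2 * k * s) +
    3 * (k - 1) * p ^+ 2 <= b * (1 + q).
  have h1 : 0 <= q * (b - 1 - 2 * p) by rewrite mulr_ge0 //; lra.
  have h3 : 0 <= q * q by rewrite mulr_ge0.
  have h4 : 0 <= p * q by rewrite mulr_ge0.
  have h5 : 0 <= q * (2 - q) by rewrite mulr_ge0 //; lra.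
  have h2 : 0 <= (k - 1) * (q * (2 - q) + 2 * p * q) by rewrite mulr_ge0 //; lra.
  rewrite /b in h1 *; lra.
have r2 : r ^+ 2 * (1 + q) <= (1 - p) ^+ 2.
  have h1 : 0 <= q * (p + q) by rewrite mulr_ge0 //; lra.
  have h2 : r * (1 + q) <= 1 - p by lra.
  have -> : r ^+ 2 * (1 + q) = r * (r * (1 + q)) by ring.
  by rewrite expr2; apply: ler_pM => //; rewrite ?mulr_ge0 //; lra.
have b0 : 0 <= b by lra.
apply: le_trans (ler_wpM2l (sqr_ge0 r) le_b) _.
rewrite mulrCA; apply: le_trans (ler_wpM2l b0 r2) _.
rewrite -subr_ge0.
have -> : 1 - b * (1 - p) ^+ 2 = p ^+ 4 * (4 + p - 7 * p ^+ 2 + 3 * p ^+ 3).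
  by rewrite /b /end_weight; ring.
rewrite mulr_ge0 ?exprn_ge0 //.
(* The cubic equals [h1 + 2 h2 + 2 h3 + 1]. *)
have h1 : 0 <= (1 - p) * (1 - p) * (1 + p) by rewrite !mulr_ge0 //; lra.
have h2 : 0 <= (1 - p) * (1 + p) by rewrite mulr_ge0 //; lra.
have h3 : 0 <= p * (p - 1) ^+ 2 by rewrite mulr_ge0 ?sqr_ge0.
lra.
Qed.

Lemma weight_decreases (E : nat -> (seq symbol -> R) -> R)
    (p0 : 0 <= p) (q0 : 0 <= q) (pq1 : p + q <= 1) : invariant_law E ->
  weight (fun L f => E L.+2 (step phi L f)) +
    decay * (pattern_prob E (nseq 3 n) - pattern_prob E (nseq 3 o)) <= weight E.
Proof.
move=> hE.
have p1 : 0 <= 1 - p by lra.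
have r0 : 0 <= r by lra.
have s0 : 0 <= s by lra.
have p01 : 0 <= p <= 1 by lra.
have kp := end_weight_ge p01.
have k2 := end_weight_le2 p01.
have pr0 : 0 <= p * r ^+ 2 by apply: mulr_ge0 => //; exact: sqr_ge0.
have ppr0 : 0 <= p ^+ 2 * r ^+ 2 by apply: mulr_ge0; exact: sqr_ge0.
rewrite /weight !(run3_image hE (@not_one_image _ p q)).
rewrite !(run3_image hE (@zero_image _ p q)) !(run4_image hE (@not_one_image _ p q)).
rewrite !(run4_image hE (@zero_image _ p q)).
rewrite unknown_zeros_image // zeros_unknown_image //.
rewrite (not_one_zeros hE) (zeros_not_one hE).
have G1 := run_convex3 hE; have G2 := run_convex4 hE.
have e1 := run_end_ge0 hE; have t2 := zero_end2 hE; have t3 := zero_end3 hE.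
have b5 := zero_end_le hE.
have := pattern_prob_ge0 hE (u :: nseq 3 o).
have := pattern_prob_ge0 hE (rcons (nseq 3 o) u).
have := pattern_prob_ge0 hE (u :: nseq 4 o).
have := pattern_prob_ge0 hE (rcons (nseq 4 o) u).
have M0 := zero_end_coef_ge0 p0 q0 pq1; have B0 := run_end_coef_ge0 p0 q0 pq1.
rewrite /decay.
(* Pattern probabilities and [k] become free variables: of [end_weight] only the bounds [kp], [k2],
   [M0] and [B0] are kept. *)
move: (pattern_prob E) G1 G2 e1 t2 t3 b5 => P.
move: k kp k2 M0 B0 => k.
move: (P (nseq 3 n)) (P (nseq 4 n)) (P (nseq 5 n)) (P (nseq 6 n)) => n3 n4 n5 n6.
move: (P (nseq 3 o)) (P (nseq 4 o)) (P (nseq 5 o)) (P (nseq 6 o)) => o3 o4 o5 o6.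
move: (P (u :: nseq 3 o)) (P (u :: nseq 4 o)) (P (u :: nseq 5 o)) => u3 u4 u5.
move: (P (rcons (nseq 3 o) u)) (P (rcons (nseq 4 o) u)) (P (rcons (nseq 5 o) u)) => v3 v4 v5.
move: (P (nseq 2 n ++ nseq 3 o)) (P (nseq 3 n ++ nseq 3 o)) => h2 h3.
move: (P (nseq 3 o ++ nseq 2 n)) (P (nseq 3 o ++ nseq 3 n)) => i2 i3.
move=> kp k2 M0 B0.
rewrite -subr_ge0 => G1; rewrite -subr_ge0 => G2; rewrite -subr_ge0 => e1.
rewrite -subr_ge0 => t2; rewrite -subr_ge0 => t3; rewrite -subr_ge0 => b5.
move=> v40 u40 v30 u30; rewrite -subr_ge0.
have c4 : 0 <= 2 * (k - 1) * (p ^+ 2 * r ^+ 2) by rewrite !mulr_ge0 //; lra.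
have c3 : 0 <= p * r ^+ 2 * (3 - 4 * s + 2 * k * s).
  rewrite mulr_ge0 //.
  have : 0 <= (2 * k - 2) * s by rewrite mulr_ge0 //; lra.
  lra.
have k3 : 0 <= k * (p ^+ 2 * r ^+ 2) by rewrite mulr_ge0 //; lra.
have k23 : 0 <= k * s * (p * r ^+ 2) by rewrite !mulr_ge0 //; lra.
have T4 : 0 <= p * r ^+ 2 * (3 * q + (k - 1) * (s + p) - p).
  rewrite mulr_ge0 //.
  have : 0 <= (k - 1 - p) * (s + p) by rewrite mulr_ge0 //; lra.
  have : 0 <= q * (1 - p) by rewrite mulr_ge0 //.
  have : 0 <= p * p by rewrite mulr_ge0 //.
  lra.
have T5 : 0 <= (2 - k) * (p ^+ 2 * r ^+ 2) by rewrite mulr_ge0 //; lra.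
have {}B0 : 0 <= 1 - r ^+ 2 * (3 * s - 3 * s ^+ 2 + k * s ^+ 2 +
    p * (3 - 4 * s + 2 * k * s) + 3 * (k - 1) * p ^+ 2) by rewrite subr_ge0.
(* The decrease of the weight is a combination of the pattern inequalities whose
   coefficients are nonnegative polynomials in [p], [q] and [k]. *)
have := addr_ge0 (mulr_ge0 c4 G2) (addr_ge0
  (mulr_ge0 (addr_ge0 c3 (addr_ge0 c4 c4)) G1) (addr_ge0
  (mulr_ge0 B0 e1) (addr_ge0
  (mulr_ge0 k3 t3) (addr_ge0
  (mulr_ge0 (addr_ge0 k3 k23) t2) (addr_ge0
  (mulr_ge0 T4 (addr_ge0 u40 v40)) (addr_ge0
  (mulr_ge0 T5 b5)
  (mulr_ge0 M0 (addr_ge0 u30 v30)))))))).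
have ge0_eq (a b : R) : 0 <= a -> a = b -> 0 <= b by move=> ? <-.
by move/ge0_eq; apply; ring.
Qed.

End Weight.

(** * The process started from unknown symbols *)

(** The letterwise order with ? above 0 and 1, which are incomparable; [all2] also makes words of
    different lengths incomparable. *)
Definition vaguer (v w : seq symbol) : bool :=
  all2 (fun a b => (b == Unknown) || (a == b)) v w.

Lemma vaguer_refl v : vaguer v v.
Proof. by elim: v => //= a v ->; rewrite eqxx orbT. Qed.

Lemma vaguer_nseq v : vaguer v (nseq (size v) Unknown).
Proof. by elim: v. Qed.

Section Increasing.
Context {R : realType}.

Definition increasing (L : nat) (f : seq symbol -> R) : Prop :=
  forall v w, size v = L -> vaguer v w -> f v <= f w.

Lemma step_le (phi : symbol -> symbol -> symbol -> symbol -> R) L f g v :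
  (forall a b c d, 0 <= phi a b c d) ->
  (forall w, size w = L -> f w <= g w) -> step phi L f v <= step phi L g v.
Proof.
move=> phi0 fg; rewrite /step !big_seq; apply: ler_sum => w.
by rewrite mem_words => /eqP/fg; apply: ler_wpM2l; apply: word_prob_ge0.
Qed.

Context (p q : R).
Local Notation phi := (envelope_matrix p q).

Section Matrix.
Hypothesis hpq : [/\ 0 <= p, 0 <= q & p + q <= 1].

Lemma envelope_ge0 a b c d : 0 <= phi a b c d.
Proof. by case: hpq => p0 q0 pq1; case: a; case: b; case: c; case: d; cbn; lra. Qed.

Lemma envelope_sum1 a b c : \sum_(d <- symbols) phi a b c d = 1.
Proof. by rewrite !big_cons big_nil; case: a; case: b; case: c; cbn; ring. Qed.

(** Making letters vaguer either keeps the transition law or moves mass [r] to ?: from 1 if the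
    triple was 000, from 0 if it contained a 1. *)
Lemma envelope_increasing a b c a' b' c' (g g' : symbol -> R) :
  vaguer [:: a; b; c] [:: a'; b'; c'] ->
  (forall x, g x <= g' x) -> (forall x, g' x <= g' Unknown) ->
  \sum_(x <- symbols) phi a b c x * g x <= \sum_(x <- symbols) phi a' b' c' x * g' x.
Proof.
move=> abc gg' g'u.
have r0 : 0 <= 1 - p - q by case: hpq; lra.
apply: (@le_trans _ _ (\sum_(x <- symbols) phi a b c x * g' x)).
  by apply: ler_sum => x _; apply: ler_wpM2l => //; exact: envelope_ge0.
have h0 : 0 <= (1 - p - q) * (g' Unknown - g' Zero) by rewrite mulr_ge0 // subr_ge0.
have h1 : 0 <= (1 - p - q) * (g' Unknown - g' One) by rewrite mulr_ge0 // subr_ge0.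
clear -abc h0 h1; rewrite !big_cons !big_nil; move: abc.
by case: a; case: a' => //; case: b; case: b' => //; case: c; case: c' => // _;
  cbn; lra.
Qed.

Lemma step_increasing L f : increasing L f -> increasing L.+2 (step phi L f).
Proof.
elim: L f => [|L IH] f hf v w; first by rewrite !step0.
move: v w => [|a [|b [|c v]]] [|a' [|b' [|c' w]]] //=; try by rewrite /vaguer /= ?andbF.
move=> [sv] vw; rewrite !stepS /=.
have [abc bcv] : vaguer [:: a; b; c] [:: a'; b'; c'] /\
    vaguer [:: b, c & v] [:: b', c' & w].
  by move: vw; rewrite /vaguer /= => /and4P[-> -> -> ->].
(* The first image letter is revealed: the induction hypothesis compares the remaining letters, and
   [step_le] shows that ? is its best value. *)
apply: envelope_increasing => // x.
  apply: IH => //=; last by rewrite sv.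
  by move=> u u' su uu'; apply: hf; rewrite /= ?su //= /vaguer /= eqxx orbT.
apply: step_le; first exact: envelope_ge0.
by move=> u su; apply: hf; rewrite /= ?su //=; apply: vaguer_refl.
Qed.

End Matrix.

(** The dual description of the law after [n] steps from all ?'s: the test function is pulled back
    [n] times, on windows growing by two, and evaluated on a finite word of ?'s. *)
Fixpoint law_from_unknown (n : nat) : nat -> (seq symbol -> R) -> R :=
  if n is m.+1 then fun L f => law_from_unknown m L.+2 (step phi L f)
  else fun L f => f (nseq L Unknown).

Hypothesis hpq : [/\ 0 <= p, 0 <= q & p + q <= 1].

Lemma invariant_law_from_unknown n : invariant_law (law_from_unknown n).
Proof.
elim: n => [|n IH].
  split => //= [L f f0|L f]; first by rewrite f0 ?size_nseq.
  by rewrite -[_ :: _]/(nseq L.+1 Unknown) take_nseq.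
exact: (step_invariant_law IH (envelope_ge0 hpq) envelope_sum1).
Qed.


(** * The probability of a ? becomes arbitrarily small *)

Section Decay.
Hypothesis pq0 : 0 < p + q.

(** The terms in A_4 contribute at least -2, and the others are nonnegative. *)
Lemma weight_le (E : nat -> (seq symbol -> R) -> R) : invariant_law E ->
  - 2 <= weight p E.
Proof.
move=> hE; rewrite /weight.
have [p0 q0 pq1] := hpq.
have p01 : 0 <= p <= 1 by lra.
have kp := end_weight_ge p01.
have := zeros_le_not_one3 hE.
have := pattern_prob_le1 hE (nseq 4 not_one).
have := pattern_prob_ge0 hE (nseq 4 is_zero).
have h : 0 <= end_weight p * (pattern_prob E (is_unknown :: nseq 3 is_zero) +
     pattern_prob E (rcons (nseq 3 is_zero) is_unknown)).
  by apply: mulr_ge0; [lra|apply: addr_ge0; exact: pattern_prob_ge0].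
lra.
Qed.

Definition unknown_prob (n : nat) : R :=
  pattern_prob (law_from_unknown n) [:: is_unknown].

Lemma unknown_probS n : unknown_prob n.+1 = (1 - p - q) *
  (pattern_prob (law_from_unknown n) (nseq 3 not_one) -
   pattern_prob (law_from_unknown n) (nseq 3 is_zero)).
Proof.
have hE := invariant_law_from_unknown n.
rewrite -(lawN hE) -(lawD hE) -(lawZ hE); apply: (law_eq hE).
case=> [|a [|b [|c [|]]]] // _.
by rewrite step_matches unknown_image step0 mulr1.
Qed.

(** Otherwise the weight would drop by at least [decay p q * e] at each step, against
    [weight_le]. *)
Lemma unknown_prob_lt_eps (e : R) : 0 < e -> exists n, unknown_prob n < e.
Proof.
have [p0 q0 pq1] := hpq => e0; apply: contrapT => /forallNP he.
have eu n : e <= unknown_prob n by rewrite leNgt; apply/negP/he.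
have d0 := decay_gt0 p0 q0 pq0 pq1.
pose W n := weight p (law_from_unknown n).
have WS n : W n.+1 + decay p q * e <= W n.
  have hE := invariant_law_from_unknown n.
  apply: le_trans (weight_decreases p0 q0 pq1 hE).
  rewrite lerD2l; apply: ler_wpM2l; first exact: ltW.
  apply: le_trans (eu n.+1) _; rewrite unknown_probS.
  have h0 := zeros_le_not_one3 hE.
  by apply: ler_piMl; lra.
have Wn n : W n + n%:R * (decay p q * e) <= W 0.
  elim: n => [|n IH]; first by rewrite mul0r addr0.
  by have := WS n; rewrite -natr1; lra.
have de : 0 < decay p q * e by rewrite mulr_gt0.
have W2 n : n%:R * (decay p q * e) <= W 0 + 2.
  by have := weight_le (invariant_law_from_unknown n); have := Wn n; rewrite /W; lra.
have h0 : 0 <= (W 0 + 2) / (decay p q * e).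
  by apply: divr_ge0; [have := W2 0%N; rewrite mul0r|exact: ltW].
by have := archi_boundP h0; rewrite ltr_pdivrMr // ltNge W2.
Qed.

End Decay.
End Increasing.

(** * Stationary measures *)

Fixpoint window (L : nat) (x : int) (eta : int -> symbol) : seq symbol :=
  if L is L'.+1 then eta x :: window L' (x + 1) eta else [::].

Lemma size_window L x eta : size (window L x eta) = L.
Proof. by elim: L x => //= L IH x; rewrite IH. Qed.

Definition window_event (x : int) (w : seq symbol) : set config :=
  [set eta : config | window (size w) x eta = w].

Lemma measurable_coordinate (x : int) (a : symbol) :
  measurable [set eta : config | eta x = a].
Proof.
apply: sub_sigma_algebra; exists [fset x]%fset, (fun _ => a).
apply/seteqP; split=> [eta /= <- n|eta /= -> //]; last by rewrite inE.
by rewrite inE => /eqP ->.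
Qed.

Lemma measurable_window_event x w : measurable (window_event x w).
Proof.
elim: w x => [|a w IH] x.
  by rewrite (_ : window_event _ _ = setT) //; apply/seteqP; split.
rewrite (_ : window_event _ _ =
  [set eta : config | eta x = a] `&` window_event (x + 1) w).
  by apply: measurableI => //; exact: measurable_coordinate.
by apply/seteqP; split=> eta; rewrite /window_event /= => -[-> ->].
Qed.

Section Windows.
Context {R : realType}.

Lemma independent_window (nu : {measure set config -> \bar R}) x w :
  independent_coordinates nu ->
  nu (window_event x w) = (\prod_(i <- iota 0 (size w))
    nu [set xi : config | xi (x + i%:Z)%R = nth Unknown w i])%E.
Proof.
pose sites : seq int := [seq x + i%:Z | i <- iota 0 (size w)].
(* At the site [n = x + i], the index [i] is recovered as the absolute value of [n - x]. *)
move=> /(_ [fset n in sites]%fset (fun n => [set nth Unknown w `|n - x|%N])) H.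
have -> : window_event x w = [set xi : config | forall n : int,
    n \in [fset n in sites]%fset -> [set nth Unknown w `|n - x|%N] (xi n)].
  have windowP (v : seq symbol) (xi : int -> symbol) y :
      window (size v) y xi = v <->
      (forall i, (i < size v)%N -> xi (y + i%:Z) = nth Unknown v i).
    elim: v y => [|b v IH] y /=; first by split.
    split=> [[xib /IH h] [|i] iv /=|h].
    - by rewrite addr0.
    - by rewrite -h // intS addrA.
    - congr (_ :: _); first by rewrite -[y]addr0 (h 0%N).
      by apply/IH => i iv; have /= <- := h i.+1 iv; rewrite intS addrA.
  apply/seteqP; split=> xi /=; rewrite /window_event /=.
    move=> /windowP h m; rewrite in_fset => /mapP[i + ->].
    by rewrite mem_iota add0n => /h ->; rewrite addrC addKr absz_nat.
  move=> h; apply/windowP => i iw.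
  rewrite h; first by rewrite addrC addKr absz_nat.
  by rewrite in_fset; apply: map_f; rewrite mem_iota.
rewrite H (perm_big sites) /=; last first.
  apply: uniq_perm; first exact: fset_uniq.
    by rewrite map_inj_uniq ?iota_uniq // => i j /addrI [].
  by move=> n; rewrite in_fset.
rewrite big_map; apply: eq_bigr => i _; congr (nu _).
by apply/seteqP; split=> xi /=; rewrite addrC addKr absz_nat.
Qed.

Lemma PCA_window (phi : symbol -> symbol -> symbol -> symbol -> R)
    (F : R.-pker config ~> config) (eta : config) x w :
  is_PCA phi F ->
  F eta (window_event x w) = (word_prob phi (window (size w).+2 x eta) w)%:E.
Proof.
move=> /(_ eta)[Fphi /independent_window ->].
under eq_bigr do rewrite Fphi.
elim: w x => [|a w IH] x; first by rewrite big_nil.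
rewrite [iota _ _]/= big_cons [word_prob _ _ _]/= EFinM; congr (_ * _)%E.
  by rewrite /= addr0 -(addrA x 1 1).
rewrite -(IH (x + 1)) (iotaDl 1 0) big_map; apply: eq_bigr => i _ /=.
by rewrite PoszD !addrA.
Qed.

Variable mu : probability config R.

Lemma integral_window L x (g : seq symbol -> R) : (forall v, 0 <= g v) ->
  (\int[mu]_eta (g (window L x eta))%:E =
  (\sum_(v <- words L) g v * fine (mu (window_event x v)))%:E)%E.
Proof.
move=> g0.
transitivity (\int[mu]_eta \sum_(v <- words L)
    ((g v)%:E * (\1_(window_event x v) eta)%:E))%E.
  apply: eq_integral => eta _.
  have wL : window L x eta \in words L by rewrite mem_words size_window.
  rewrite (bigD1_seq _ wL (words_uniq L)) /= big_seq_cond big1 ?adde0.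
    by rewrite indicE mem_set ?mule1 // /window_event /= size_window.
  move=> v /andP[]; rewrite mem_words => /eqP vL vw.
  rewrite indicE memNset ?mule0 // /window_event /= vL => /esym/eqP.
  by rewrite (negbTE vw).
have mI v : measurable_fun [set: config] (EFin \o (\1_(window_event x v) : config -> R)).
  by apply/measurable_EFinP; apply: measurable_indic; exact: measurable_window_event.
rewrite ge0_integral_sum //; first last.
- by move=> v eta _; rewrite mule_ge0 // lee_fin.
- by move=> v; apply: measurable_funeM; exact: mI.
rewrite -sumEFin; apply: eq_bigr => v _.
rewrite ge0_integralZl_EFin //; last exact: mI.
rewrite integral_indic //; last exact: measurable_window_event.
rewrite setIT EFinM fineK // fin_num_measure //.
exact: measurable_window_event.
Qed.

(** A finite sum makes sense for [f] of any sign. The position [x] is kept since [mu] may fail to be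
    shift-invariant. *)
Definition window_mean (L : nat) (x : int) (f : seq symbol -> R) : R :=
  \sum_(w <- words L) f w * fine (mu (window_event x w)).

Lemma window_mean1 L x : window_mean L x (fun _ => 1) = 1.
Proof.
apply: EFin_inj; rewrite /window_mean -integral_window //.
by rewrite integral_cst // mul1e; exact: probability_setT.
Qed.

(** Stationarity is applied to window events, whose probability under [F eta] depends only on a
    window of [eta] wider by two. *)
Lemma stationary_window_mean (phi : symbol -> symbol -> symbol -> symbol -> R)
    (F : R.-pker config ~> config) L x f :
  (forall a b c d, 0 <= phi a b c d) ->
  is_PCA phi F -> stationary F mu ->
  window_mean L x f = window_mean L.+2 x (step phi L f).
Proof.
move=> phi0 hF hmu; rewrite /window_mean.
have muE w : w \in words L -> fine (mu (window_event x w)) =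
    \sum_(v <- words L.+2) word_prob phi v w * fine (mu (window_event x v)).
  rewrite mem_words => /eqP <-; apply: EFin_inj.
  rewrite fineK ?fin_num_measure //; last exact: measurable_window_event.
  rewrite -integral_window; last by move=> v; exact: word_prob_ge0.
  rewrite -hmu; last exact: measurable_window_event.
  by apply: eq_integral => eta _; exact: PCA_window.
transitivity (\sum_(w <- words L) \sum_(v <- words L.+2)
    f w * (word_prob phi v w * fine (mu (window_event x v)))).
  by rewrite !big_seq; apply: eq_bigr => w /muE ->; rewrite mulr_sumr.
rewrite exchange_big /=; apply: eq_bigr => v _; rewrite mulr_suml.
by apply: eq_bigr => w _; rewrite mulrA (mulrC (f w)).
Qed.

(** Each step back in time replaces [f] by [step phi L f], still increasing. After [n] steps, the
    value on the word of ?'s bounds the mean. *)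
Lemma stationary_le_law (p q : R) (F : R.-pker config ~> config) n L x f :
  [/\ 0 <= p, 0 <= q & p + q <= 1] ->
  is_envelope_PCA p q F -> stationary F mu -> increasing L f ->
  window_mean L x f <= law_from_unknown p q n L f.
Proof.
move=> hpq hF hmu; elim: n L f => [|n IH] L f hf /=; last first.
  rewrite (stationary_window_mean L x f (envelope_ge0 hpq) hF hmu).
  exact/IH/step_increasing.
rewrite -[leRHS]mulr1 -(window_mean1 L x) mulr_sumr /window_mean !big_seq.
apply: ler_sum => w; rewrite mem_words => /eqP wL; rewrite mul1r.
apply: ler_wpM2r; first exact/fine_ge0/measure_ge0.
by rewrite -wL; apply: hf => //; exact: vaguer_nseq.
Qed.

End Windows.

Theorem theorem2p4 (R : realType) (p q : R) (hpq : parameters (p, q))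
    (F : R.-pker config ~> config) (hF : is_envelope_PCA p q F)
    (mu : probability config R) (hmu : stationary F mu) (x : int) :
  mu [set eta : config | eta x = Unknown] = 0%E.
Proof.
move: hpq => /= [/andP[p0 _] [/andP[q0 _] /andP[pq0 pq1]]].
have h : [/\ 0 <= p, 0 <= q & p + q <= 1] by [].
have -> : [set eta : config | eta x = Unknown] = window_event x [:: Unknown].
  by apply/seteqP; split=> eta; rewrite /window_event /=; [move=> ->|case].
have mfin : mu (window_event x [:: Unknown]) \is a fin_num.
  by rewrite fin_num_measure //; exact: measurable_window_event.
rewrite -(fineK mfin); congr (_%:E); apply/le_anti/andP; split; last first.
  exact/fine_ge0/measure_ge0.
(* A positive probability would itself serve as the [e] of [unknown_prob_lt_eps], contradicting the
   comparison at that time [n]. *)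
rewrite leNgt; apply/negP => /(unknown_prob_lt_eps h pq0)[n].
apply/negP; rewrite -leNgt.
have inc : increasing 1 (fun w => (matches [:: is_unknown] w)%:R : R).
  case=> [//|a [|//]] [//|b [|b' w]] _; last by rewrite /vaguer /= andbF.
  by rewrite /vaguer /= !andbT ler_nat; case: a; case: b.
apply: le_trans (stationary_le_law n x h hF hmu inc).
rewrite /window_mean /= !big_cons big_nil /=.
by rewrite !mul0r mul1r add0r !addr0.
Qed.
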